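(* Let $R$ be a valuation ring. A bispannable matroid $M$ over $R$ on a finite ground set $E$ is determined by the modules $M(A)$ with $A\subseteq E$, $|A|=r$, where $M(\emptyset)\cong R^r$ (i.e. $r$ is the generic rank of $M$). That is, if $M$ and $M'$ are bispannable matroids over $R$ on $E$ with $M(\emptyset)\cong R^r\cong M'(\emptyset)$ and $M(A)\cong M'(A)$ for all $A\subseteq E$ with $|A|=r$, then $M(A)\cong M'(A)$ for all $A\subseteq E$.
   Context: A (finitely presented) matroid over $R$ on $E$ is a function $M$ assigning to each $A\subseteq E$ a finitely presented $R$-module $M(A)$ (only isomorphism types matter) such that for all $A\subseteq E$ and $b,c\in E$ there are $x,y\in M(A)$ with $M(A\cup\{b\})\cong M(A)/(x)$, $M(A\cup\{c\})\cong M(A)/(y)$, $M(A\cup\{b,c\})\cong M(A)/(x,y)$. $M$ is spannable if $M(E)=0$. It is cospannable if its dual is spannable; equivalently, $M(\emptyset)$ is a free $R$-module. It is bispannable if it is both spannable and cospannable. The generic rank of $M$ is the rank of the free part of $M(\emptyset)$. (The dual $M^*$ is the matroid over $R$ on $E$ determined by $t_i(M(A))=t_{|A|-r+i}(M^*(E\setminus A))$ for all integers $i$, where $r$ is the generic rank of $M$, $t_i(N)=\min_{x_1,\dots,x_i\in N}\operatorname{length}(N/\langle x_1,\dots,x_i\rangle)$ for $i\ge0$, $t_i(N)=\infty$ for $i<0$, and $\operatorname{length}(\bigoplus_jR/(x_j))=\sum_j\operatorname{val}(x_j)$.) *)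

(* Defs.v *)
(* MathComp; boolp supplies the classical decidability needed to form quotients. *)
From HB Require Import structures.
From mathcomp Require Import all_boot all_order all_algebra.
From mathcomp Require Import boolp.

Set Implicit Arguments.
Unset Strict Implicit.
Unset Printing Implicit Defensive.

Import GRing.Theory.
Local Open Scope ring_scope.

Definition valuation_ring (R : idomainType) : Prop :=
  forall x : {fraction R},
    (exists a : R, x = tofrac a) \/ (exists a : R, x^-1 = tofrac a).

Section Span.
Variables (R : idomainType) (V : lmodType R).

Definition span_mem (xs : seq V) : {pred V} :=
  fun v => `[< exists c : 'I_(size xs) -> R, v = \sum_i c i *: xs`_i >].

Lemma span_memP (xs : seq V) (v : V) :
  reflect (exists c : 'I_(size xs) -> R, v = \sum_i c i *: xs`_i)
          (v \in span_mem xs).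
Proof. exact: asboolP. Qed.

Lemma span_mem_submod_closed (xs : seq V) : submod_closed (span_mem xs).
Proof.
split.
  apply/span_memP; exists (fun=> 0).
  by rewrite big1 // => i _; rewrite scale0r.
move=> a u v /span_memP[c ->] /span_memP[d ->].
apply/span_memP; exists (fun i => a * c i + d i).
rewrite scaler_sumr -big_split; apply: eq_bigr => i _ /=.
by rewrite scalerDl scalerA.
Qed.

HB.instance Definition _ (xs : seq V) :=
  GRing.isSubmodClosed.Build R V (span_mem xs) (span_mem_submod_closed xs).

End Span.

(* The quotient module V / <xs>: the library's quotient of additive groups,
   equipped with the induced scalar multiplication. *)
Definition quomod (R : idomainType) (V : lmodType R) (xs : seq V) : Type :=
  Quotient.quot (span_mem xs).

Section QuotientModule.
Variables (R : idomainType) (V : lmodType R) (xs : seq V).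
Local Notation Q := (quomod xs).
Local Notation pi := (\pi_(Quotient.quot (span_mem xs)))%qT.

HB.instance Definition _ := GRing.Zmodule.on Q.

Definition quomod_proj (v : V) : Q := pi v.

Lemma quomod_projP (v w : V) :
  reflect (quomod_proj v = quomod_proj w) (v - w \in span_mem xs).
Proof. by rewrite Quotient.idealrBE; apply: eqP. Qed.

Lemma quomod_reprK (u : Q) : quomod_proj (repr (u : Quotient.quot _)) = u.
Proof. exact: reprK. Qed.

Lemma quomod_projD (v w : V) :
  quomod_proj (v + w) = quomod_proj v + quomod_proj w.
Proof. exact: (raddfD pi). Qed.

Definition quomod_scale (a : R) (u : Q) : Q :=
  quomod_proj (a *: repr (u : Quotient.quot _)).

Lemma quomod_scale_proj a v :
  quomod_scale a (quomod_proj v) = quomod_proj (a *: v).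
Proof.
apply/quomod_projP; rewrite -scalerBr rpredZ //.
by apply/quomod_projP; rewrite quomod_reprK.
Qed.

Fact quomod_scaleA a b u :
  quomod_scale a (quomod_scale b u) = quomod_scale (a * b) u.
Proof. by rewrite -[u]quomod_reprK !quomod_scale_proj scalerA. Qed.

Fact quomod_scale1 : left_id 1 quomod_scale.
Proof. by move=> u; rewrite -[u]quomod_reprK quomod_scale_proj scale1r. Qed.

Fact quomod_scaleDr : right_distributive quomod_scale +%R.
Proof.
move=> a u v; rewrite -[u]quomod_reprK -[v]quomod_reprK.
by rewrite -quomod_projD !quomod_scale_proj scalerDr quomod_projD.
Qed.

Fact quomod_scaleDl u : {morph quomod_scale^~ u : a b / a + b}.
Proof.
move=> a b; rewrite -[u]quomod_reprK !quomod_scale_proj.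
by rewrite scalerDl quomod_projD.
Qed.

HB.instance Definition _ := GRing.Zmodule_isLmodule.Build R Q
  quomod_scaleA quomod_scale1 quomod_scaleDr quomod_scaleDl.

End QuotientModule.

Section Modules.
Variable R : idomainType.

Definition lmod_iso (U V : lmodType R) : Prop :=
  exists f : {linear U -> V}, bijective f.

Definition zero_module (N : lmodType R) : Prop := forall v : N, v = 0.

Definition finitely_presented (N : lmodType R) : Prop :=
  exists (n : nat) (s : seq 'rV[R]_n), lmod_iso N (quomod s).

Definition torsion_module (N : lmodType R) : Prop :=
  forall v : N, exists2 a : R, a != 0 & a *: v = 0.

(* R/(x_1) (+) ... (+) R/(x_k) for xs = [:: x_1; ...; x_k] *)
Fixpoint cyclic_sum (xs : seq R) : lmodType R :=
  if xs is x :: xs' then (quomod [:: (x : R^o)] * cyclic_sum xs')%type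
  else 'rV[R]_0.

(* Elements of the value group with infinity are represented by ring elements
   up to associates: an element a of R stands for val a.  So val a <= val b is
   divisibility of b by a, addition of values is multiplication in R, and 0
   stands for infinity. *)
Definition val_le (a b : R) : Prop := exists c : R, b = c * a.
Definition val_eq (a b : R) : Prop := val_le a b /\ val_le b a.

(* length N = val d *)
Definition has_length (N : lmodType R) (d : R) : Prop :=
  exists2 xs : seq R,
    lmod_iso N (cyclic_sum xs) & val_eq d (\prod_(x <- xs) x).

(* t_i(N) = val d *)
Definition has_t (N : lmodType R) (i : int) (d : R) : Prop :=
  match i with
  | Posz k =>
      (exists xs : k.-tuple N, has_length (quomod xs) d) /\
      (forall (xs : k.-tuple N) (e : R), has_length (quomod xs) e -> val_le d e)
  | Negz _ => d = 0
  end.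

End Modules.

Section Matroids.
Variables (R : idomainType) (E : finType).

(* The three isomorphisms are unrelated to one another: only isomorphism types
   matter. *)
Record matroid := Matroid {
  matroid_module :> {set E} -> lmodType R;
  matroid_fp : forall A : {set E}, finitely_presented (matroid_module A);
  matroid_axiom : forall (A : {set E}) (b c : E),
    exists x y : matroid_module A,
      [/\ lmod_iso (matroid_module (A :|: [set b])) (quomod [:: x]),
          lmod_iso (matroid_module (A :|: [set c])) (quomod [:: y]) &
          lmod_iso (matroid_module (A :|: [set b; c])) (quomod [:: x; y])]
}.

Definition generic_rank (M : matroid) (r : nat) : Prop :=
  exists2 T : lmodType R,
    torsion_module T & lmod_iso (M set0) ('rV[R]_r * T)%type.

Definition is_dual (M D : matroid) : Prop :=
  exists2 r : nat, generic_rank M r &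
    forall (A : {set E}) (i : int),
      exists2 d : R,
        has_t (M A) i d & has_t (D (~: A)) (#|A|%:Z - r%:Z + i) d.

Definition spannable (M : matroid) : Prop := zero_module (M [set: E]).

Definition cospannable (M : matroid) : Prop :=
  exists2 D : matroid, is_dual M D & spannable D.

Definition bispannable (M : matroid) : Prop := spannable M /\ cospannable M.

End Matroids.

(* Main.v *)
Require Import Defs.
From HB Require Import structures.
From mathcomp Require Import all_boot all_order all_algebra.
From mathcomp Require Import perm boolp.

Set Implicit Arguments.
Unset Strict Implicit.
Unset Printing Implicit Defensive.

Import GRing.Theory.
Local Open Scope ring_scope.

(** A finitely presented module N over a valuation ring is a sum of cyclic
    modules R/(l_1), ..., R/(l_n) with l_1 a multiple of l_2, l_2 of l_3, and so
    on, so N is determined by the truth values of the statements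
    N ->> (R/a)^k, which say that a divides l_k.  Everything below is about
    these statements; they are written for presenting matrices, as [onto_free].

    Adjoining an element to A kills one element x of M(A).  This moves the
    invariants by at most one place: l_(k+1)(M(A)) divides l_k(M(A)/x), which
    divides l_k(M(A)).  If M(E) = 0 and M(set0) = R^r, then for a suitable
    element the divisibilities become equalities up to units:

    - if A is not E and k >= 1 then l_(k+1)(M(A)) = l_k(M(A u e)) for some e
      not in A ([family_extend]);
    - if |A| + k > r + 1 then l_k(M(A)) = l_k(M(A \ e)) for some e in A
      ([primal_restore]).

    Together with l_k(M(A)) = 0 for |A| + k <= r, which is a count of
    generators and relations, these recursions start from the first invariant
    of the modules on r-sets and from M(set0) = R^r, so they compute everything
    from the modules on r-sets.

    The core is [exists_splitting], which gives the first equality.  For a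
    realizable matroid it is Nakayama's lemma: the classes of the vectors of E
    generate M(A), so if M(A) has a quotient R/a, with a not a unit, then one of
    them spans a free summand of M(A)/a.  In general only the local squares
    M(A), M(A u e), M(A u f), M(A u ef) are available, each with its own
    elements x and y, so the property that x spans a free summand has to be
    read off from the isomorphism types of N and N/x: this is
    [splits_off_onto] and [onto_splits_off].  Granting that, one argues by
    downward induction on A.  Take e such that N/x has a cyclic quotient R/a'
    with a' as large as possible among the divisors of a; it is not a unit,
    unless e itself splits off at a.  By induction some f splits off at a' in
    M(A u e), through h : N -> R/a' with h(x) = 0 and h(y) = 1.  If a' is not
    associated to a, take a surjection q : N -> R/a.  If p = q(y) is a unit, f
    splits off at a; otherwise q - p h is defined modulo gcd(a, a'p), vanishes
    on y and is still surjective, so N/y has a larger cyclic quotient than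
    R/a', against the choice of e.

    The second equality is the first one for the dual matroid.  Since
    M(set0) = R^r, each M(A) is presented by a matrix with |A| rows and r
    columns ([presents_card]), and transposing these matrices gives a family
    that satisfies the same local axioms ([dual_one_step], [dual_two_steps]);
    the invariants of a matrix and of its transpose agree up to a shift of the
    index ([onto_free_tr]). *)

(** * Divisibility in a valuation ring *)

Section Div.
Variable R : idomainType.
Implicit Types (a b c : R).

Lemma val_le_refl a : val_le a a.
Proof. by exists 1; rewrite mul1r. Qed.

Lemma val_le_trans b a c : val_le a b -> val_le b c -> val_le a c.
Proof. by move=> [x ->] [y ->]; exists (y * x); rewrite mulrA. Qed.

Lemma val_le0 a : val_le a 0.
Proof. by exists 0; rewrite mul0r. Qed.

Lemma val_leD a b c : val_le a b -> val_le a c -> val_le a (b + c).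
Proof. by move=> [x ->] [y ->]; exists (x + y); rewrite mulrDl. Qed.

Lemma val_leMl a b c : val_le a b -> val_le a (c * b).
Proof. by move=> [x ->]; exists (c * x); rewrite mulrA. Qed.

Lemma val_le_unit a b : a \is a GRing.unit -> val_le a b.
Proof. by move=> ua; exists (b / a); rewrite divrK. Qed.

Lemma val_le_unitP a b : b \is a GRing.unit -> val_le a b ->
  a \is a GRing.unit.
Proof. by move=> ub [c bE]; move: ub; rewrite bE unitrM => /andP[]. Qed.

Lemma val_le1 a : val_le a 1 <-> a \is a GRing.unit.
Proof.
by split; [apply: val_le_unitP; rewrite unitr1 | apply: val_le_unit].
Qed.

Hypothesis hR : valuation_ring R.

(** The only place where the fraction field enters: from here on, being a
    valuation ring means that divisibility is total. *)
Lemma val_le_total a b : val_le a b \/ val_le b a.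
Proof.
have [->|b0] := eqVneq b 0; first by left; apply: val_le0.
have [->|a0] := eqVneq a 0; first by right; apply: val_le0.
have [[c hc]|[c hc]] := hR (tofrac a / tofrac b).
  right; exists c; apply/eqP; rewrite -tofrac_eq tofracM -hc divfK //.
  by rewrite tofrac_eq0.
left; exists c; apply/eqP; rewrite -tofrac_eq tofracM -hc invf_div divfK //.
by rewrite tofrac_eq0.
Qed.

(** A valuation ring is local: of two non-units one divides the other, hence
    also their sum. *)
Lemma nonunitD a b : a \isn't a GRing.unit -> b \isn't a GRing.unit ->
  a + b \isn't a GRing.unit.
Proof.
move=> ua ub; case: (val_le_total a b) => -[c E]; apply/negP.
  by move: ua => /[swap]; rewrite E -{1}[a]mul1r -mulrDl unitrM => /andP[_ ->].
by move: ub => /[swap]; rewrite E -{2}[b]mul1r -mulrDl unitrM => /andP[_ ->].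
Qed.

Lemma nonunitM a b : b \isn't a GRing.unit -> a * b \isn't a GRing.unit.
Proof. by rewrite unitrM negb_and orbC => ->. Qed.

End Div.

Lemma total_preorder_min (T : eqType) (le : T -> T -> Prop) (s : seq T) :
  (forall x y, le x y \/ le y x) ->
  (forall y x z, le x y -> le y z -> le x z) -> s != [::] ->
  exists2 x, x \in s & forall y, y \in s -> le x y.
Proof.
move=> tot tr; have refl x : le x x by case: (tot x x).
elim: s => // a s IH _; have [->|s0] := eqVneq s [::].
  by exists a; rewrite ?mem_head // => b; rewrite inE => /eqP->.
have [c cs cmin] := IH s0; have [ac|ca] := tot a c.
  exists a; rewrite ?mem_head // => b; rewrite inE => /predU1P[->//|/cmin].
  exact: tr.
exists c; first by rewrite inE cs orbT.
by move=> b; rewrite inE => /predU1P[->|/cmin].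
Qed.

(** * Divisibility of matrices by a scalar *)

Section DivMx.
Variable R : idomainType.
Implicit Types (a b c : R).

Definition dvdmx a m n (X : 'M[R]_(m, n)) : Prop := exists Z, X = a *: Z.

Lemma dvdmx0 a m n : dvdmx a (0 : 'M_(m, n)).
Proof. by exists 0; rewrite scaler0. Qed.

Lemma dvdmxD a m n (X Y : 'M_(m, n)) : dvdmx a X -> dvdmx a Y -> dvdmx a (X + Y).
Proof. by move=> [x ->] [y ->]; exists (x + y); rewrite scalerDr. Qed.

Lemma dvdmxN a m n (X : 'M_(m, n)) : dvdmx a X -> dvdmx a (- X).
Proof. by move=> [x ->]; exists (- x); rewrite scalerN. Qed.

Lemma dvdmxB a m n (X Y : 'M_(m, n)) : dvdmx a X -> dvdmx a Y -> dvdmx a (X - Y).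
Proof. by move=> hX hY; apply: dvdmxD => //; apply: dvdmxN. Qed.

Lemma dvdmx_mull a m n p (X : 'M_(m, n)) (Y : 'M_(n, p)) :
  dvdmx a Y -> dvdmx a (X *m Y).
Proof. by move=> [y ->]; exists (X *m y); rewrite scalemxAr. Qed.

Lemma dvdmx_mulr a m n p (X : 'M_(m, n)) (Y : 'M_(n, p)) :
  dvdmx a X -> dvdmx a (X *m Y).
Proof. by move=> [x ->]; exists (x *m Y); rewrite scalemxAl. Qed.

Lemma dvdmx_trans b a m n (X : 'M_(m, n)) :
  val_le a b -> dvdmx b X -> dvdmx a X.
Proof. by move=> [c ->] [x ->]; exists (c *: x); rewrite scalerA mulrC. Qed.

Lemma dvdmx_scale a b c m n (X : 'M_(m, n)) :
  val_le b (a * c) -> dvdmx a X -> dvdmx b (c *: X).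
Proof.
move=> h [x ->]; rewrite scalerA mulrC; apply: dvdmx_trans h _.
by exists x.
Qed.

Lemma dvdmx_unit a m n (X : 'M_(m, n)) : a \is a GRing.unit -> dvdmx a X.
Proof. by move=> ua; exists (a^-1 *: X); rewrite scalerA divrr // scale1r. Qed.

Lemma dvdmxP a m n (X : 'M_(m, n)) :
  dvdmx a X <-> forall i j, val_le a (X i j).
Proof.
split=> [[Z ->] i j|/(_ _ _)/cid h]; first by exists (Z i j); rewrite mxE mulrC.
exists (\matrix_(i, j) sval (h i j)); apply/matrixP => i j; rewrite !mxE.
by case: (h i j) => c /= ->; rewrite mulrC.
Qed.

Lemma dvdmx_mxsub a m n m' n' (f : 'I_m' -> 'I_m) (g : 'I_n' -> 'I_n)
    (X : 'M_(m, n)) :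
  dvdmx a X -> dvdmx a (mxsub f g X).
Proof. by move=> /dvdmxP h; apply/dvdmxP => i j; rewrite mxE. Qed.

Lemma dvdmx_col a m1 m2 n (X : 'M_(m1, n)) (Y : 'M_(m2, n)) :
  dvdmx a (col_mx X Y) <-> dvdmx a X /\ dvdmx a Y.
Proof.
split=> [[Z E]|[[x ->] [y ->]]]; last by exists (col_mx x y); rewrite scale_col_mx.
split; [exists (usubmx Z) | exists (dsubmx Z)].
  by rewrite -linearZ /= -E col_mxKu.
by rewrite -linearZ /= -E col_mxKd.
Qed.

Lemma dvdmx_row a m n1 n2 (X : 'M_(m, n1)) (Y : 'M_(m, n2)) :
  dvdmx a (row_mx X Y) <-> dvdmx a X /\ dvdmx a Y.
Proof.
split=> [[Z E]|[[x ->] [y ->]]]; last by exists (row_mx x y); rewrite scale_row_mx.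
split; [exists (lsubmx Z) | exists (rsubmx Z)].
  by rewrite -linearZ /= -E row_mxKl.
by rewrite -linearZ /= -E row_mxKr.
Qed.

(** Padding both factors to square matrices creates a zero column. *)
Lemma det_mul_narrow k l (X : 'M[R]_(k, l)) (Y : 'M_(l, k)) :
  (l < k)%N -> \det (X *m Y) = 0.
Proof.
move=> lk; have /subnK E := ltnW lk; move: lk; rewrite -subn_gt0.
move: (k - l)%N E => [//|d] E _; case: k / E X Y => X Y.
have -> : X *m Y = row_mx (0 : 'M_(_, d.+1)) X *m
                   (col_mx (0 : 'M_(d.+1, _)) Y : 'M_(d.+1 + l, _)).
  by rewrite mul_row_col mul0mx add0r.
rewrite det_mulmx; set A := row_mx _ _.
have A0 i : A i (lshift l ord0) = 0 by rewrite row_mxEl mxE.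
by rewrite (expand_det_col A (lshift l ord0)) big1 ?mul0r // => i _; rewrite A0 mul0r.
Qed.

(** Determinants are polynomial in the entries, so they respect congruence
    modulo an ideal. *)
Lemma det_congr (I : R -> Prop) n (X Y : 'M[R]_n) :
  I 0 -> (forall x y, I x -> I y -> I (x + y)) ->
  (forall x y, I y -> I (x * y)) ->
  (forall i j, I (X i j - Y i j)) -> I (\det X - \det Y).
Proof.
move=> I0 ID IM IXY; pose E x y := I (x - y).
apply: (big_ind2 E); first by rewrite /E subr0.
  by move=> x x' y y' h h'; rewrite /E opprD addrACA; apply: ID.
move=> s _; rewrite /E -mulrBr; apply: (IM); apply: (big_ind2 E) => //.
  by rewrite /E subrr.
  move=> x x' y y' h h'; rewrite /E.
have -> : x * y - x' * y' = y * (x - x') + x' * (y - y').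
  by rewrite !mulrBr [y * x]mulrC [y * x']mulrC addrA subrK.
  by apply: (ID); apply: (IM).
by move=> i _; apply: IXY.
Qed.

End DivMx.

(** * Free quotients modulo a of a cokernel *)

Section OntoFree.
Variable R : idomainType.
Implicit Types (a b c : R).

(** The cokernel of Q (columns are generators, rows are relations) surjects
    onto the k-th power of R/a: P lists the images of the generators and L a
    preimage of the standard basis.  Stating it through congruences avoids
    quotient rings, and makes it true for every k when a is a unit. *)
Definition onto_free m n (Q : 'M[R]_(m, n)) (k : nat) a : Prop :=
  exists P : 'M_(n, k), exists2 L : 'M_(k, n),
    dvdmx a (Q *m P) & dvdmx a (L *m P - 1%:M).

Lemma onto_free_unit m n (Q : 'M_(m, n)) k a :
  a \is a GRing.unit -> onto_free Q k a.
Proof. by move=> ua; exists 0, 0; apply: dvdmx_unit. Qed.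

Lemma onto_freeW m n (Q : 'M_(m, n)) k a : onto_free Q k.+1 a -> onto_free Q k a.
Proof.
move=> [P [L h1 h2]].
exists (col' ord0 P), (row' ord0 L).
  by rewrite col'Esub mulmx_colsub; apply: dvdmx_mxsub.
rewrite row'Esub col'Esub -mxsub_mul; move/dvdmx_mxsub: h2 => /(_ _ _ (lift ord0) (lift ord0)).
congr (dvdmx a _); apply/matrixP => i j; rewrite !mxE (inj_eq lift_inj) //.
Qed.

Lemma onto_free_le m n (Q : 'M_(m, n)) j k a :
  (j <= k)%N -> onto_free Q k a -> onto_free Q j a.
Proof. by move/subnK <-; elim: (k - j)%N => // l IH /onto_freeW. Qed.

Lemma onto_free_col m1 m2 n (Q : 'M_(m1, n)) (X : 'M_(m2, n)) k a :
  onto_free (col_mx Q X) k a -> onto_free Q k a.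
Proof.
move=> [P [L]]; rewrite mul_col_mx => /dvdmx_col[h1 _] h2.
by exists P, L.
Qed.

Lemma onto_free_mull m1 m2 n (A : 'M_(m2, m1)) (Q : 'M_(m1, n)) k a :
  onto_free Q k a -> onto_free (A *m Q) k a.
Proof.
by move=> [P [L h1 h2]]; exists P, L => //; rewrite -mulmxA; apply: dvdmx_mull.
Qed.

Lemma onto_free_mulr m n (U : 'M_n) (Q : 'M_(m, n)) k a : U \in unitmx ->
  onto_free Q k a -> onto_free (Q *m U) k a.
Proof.
move=> Uu [P [L h1 h2]]; exists (invmx U *m P), (L *m U).
  by rewrite mulmxA mulmxK.
by rewrite mulmxA mulmxK.
Qed.

Lemma onto_free_equiv m n (A : 'M_m) (U : 'M_n) (Q : 'M_(m, n)) k a :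
  A \in unitmx -> U \in unitmx ->
  onto_free (A *m Q *m U) k a <-> onto_free Q k a.
Proof.
move=> Au Uu; split=> [h|h]; last by apply: onto_free_mulr => //; apply: onto_free_mull.
have -> : Q = invmx A *m (A *m Q *m U *m invmx U) by rewrite mulmxK // mulKmx.
by apply/onto_free_mull/onto_free_mulr; rewrite ?unitmx_inv.
Qed.

Hypothesis hR : valuation_ring R.

(** A row over a valuation ring is a multiple of a unimodular row, whose kernel
    is a free direct summand of corank one. *)
Lemma row_kernel k (p : 'rV[R]_k.+1) :
  exists U : 'M_(k.+1, k), exists2 W : 'M_(k, k.+1), p *m U = 0 & W *m U = 1%:M.
Proof.
have [||//|x0 /codomP[j ->] jmin] := @total_preorder_min _ (@val_le R) (codom (p 0)).
- exact: val_le_total.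
- exact: val_le_trans.
- by rewrite -size_eq0 size_codom card_ord.
have {}jmin i : exists c, p 0 (lift j i) = c * p 0 j by apply: jmin; apply: codom_f.
pose c := \row_i sval (cid (jmin i)).
have cP i : p 0 (lift j i) = c 0 i * p 0 j by rewrite mxE; case: (cid _).
exists (colsub (lift j) 1%:M - delta_mx j 0 *m c), (rowsub (lift j) 1%:M).
  rewrite mulmxBr mulmx_colsub mulmx1 mulmxA -colE; apply/rowP => i.
  by rewrite !mxE big_ord1 cP !mxE mulrC subrr.
rewrite mulmxBr -!rowsubE; apply/matrixP => i l.
rewrite !mxE big_ord1 !mxE (inj_eq lift_inj) [_ == j]eq_sym (negPf (neq_lift _ _)).
by rewrite /= mul0r subr0.
Qed.

(** Killing one element lowers the number of free summands by at most one:
    the image of x in the k+1-st power is a multiple of a unimodular vector, so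
    a power with exponent k survives. *)
Lemma onto_free_row m n (Q : 'M_(m, n)) (x : 'rV_n) k a :
  onto_free Q k.+1 a -> onto_free (col_mx Q x) k a.
Proof.
move=> [P [L h1 h2]]; have [U [W pU WU]] := row_kernel (x *m P).
exists (P *m U), (W *m L).
  rewrite mul_col_mx !mulmxA pU; apply/dvdmx_col; split; last exact: dvdmx0.
  exact: dvdmx_mulr.
have -> : W *m L *m (P *m U) - 1%:M = W *m (L *m P - 1%:M) *m U.
  by rewrite mulmxBr mulmxBl !mulmxA mulmx1 WU.
by apply: dvdmx_mulr; apply: dvdmx_mull.
Qed.

End OntoFree.

(** * Smith normal form *)

Section Smith.
Variable R : idomainType.
Implicit Types (a b c : R) (d : nat -> R).

Definition smith_mx m n d : 'M[R]_(m, n) :=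
  \matrix_(i, j) (d i *+ (i == j :> nat)).

Definition val_chain d := forall i j, (i <= j)%N -> val_le (d i) (d j).

Lemma tr_smith_mx m n d : (smith_mx m n d)^T = smith_mx n m d.
Proof.
apply/matrixP => i j; rewrite !mxE eq_sym.
by case: eqP => // ->.
Qed.

Lemma unitmx_block_diag m n (A : 'M[R]_m) (B : 'M_n) :
  A \in unitmx -> B \in unitmx -> block_mx A 0 0 B \in unitmx.
Proof. by move=> uA uB; rewrite unitmxE det_ublock unitrM -!unitmxE uA. Qed.

Hypothesis hR : valuation_ring R.

(** The pivot divides all other entries, so it can be factored out of the
    whole matrix before the induction; the divisibility chain comes for free.
    The invariants d i beyond the diagonal are zero, which is what surplus
    generators contribute to the cokernel. *)
Lemma smith_form m n (Q : 'M[R]_(m, n)) :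
  exists A U d, [/\ A \in unitmx, U \in unitmx, val_chain d,
    forall i, (minn m n <= i)%N -> d i = 0 & A *m Q *m U = smith_mx m n d].
Proof.
(* Covers the zero matrix, hence also the matrices without rows or columns. *)
have trivial_case m' n' : exists (A : 'M_m') (U : 'M_n') d,
    [/\ A \in unitmx, U \in unitmx, val_chain d,
     forall i, (minn m' n' <= i)%N -> d i = 0 & A *m 0 *m U = smith_mx m' n' d].
  exists 1%:M, 1%:M, (fun=> 0); split; rewrite ?unitmx1 //.
    by move=> i j _; apply: val_le_refl.
  by rewrite mulmx0 mul0mx; apply/matrixP => i j; rewrite !mxE mul0rn.
elim: m n Q => [|m IH] [|n] Q; rewrite ?[Q]flatmx0 ?[Q]thinmx0 //.
have [||//|x0 /codomP[[i0 j0] ->] pmin] := @total_preorder_min _ (@val_le R)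
    (codom (fun ij : 'I_m.+1 * 'I_n.+1 => Q ij.1 ij.2)).
- exact: val_le_total.
- exact: val_le_trans.
- by rewrite -size_eq0 size_codom card_prod !card_ord.
rewrite /= in pmin.
have [p0|p0] := eqVneq (Q i0 j0) 0.
  rewrite (_ : Q = 0) //; apply/matrixP => i j; rewrite mxE.
  have [|c ->] := pmin (Q i j); last by rewrite p0 mulr0.
  exact: (codom_f _ (i, j)).
set p := Q i0 j0 in pmin p0.
pose Q1 := tperm_mx ord0 i0 *m Q *m tperm_mx ord0 j0.
have Q1E i j : Q1 i j = Q (tperm ord0 i0 i) (tperm ord0 j0 j).
  by rewrite /Q1 -xrowE -xcolE !mxE.
have [Q2 Q2E] : dvdmx p Q1.
  apply/dvdmxP => i j; rewrite Q1E; apply: pmin.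
  exact: (codom_f _ (tperm ord0 i0 i, tperm ord0 j0 j)).
have Q200 : Q2 ord0 ord0 = 1.
  have := Q1E ord0 ord0; rewrite Q2E mxE !tpermL => h.
  by apply: (mulfI p0); rewrite mulr1.
(* The same matrix, typed so that it splits into blocks. *)
pose Q3 : 'M_(1 + m, 1 + n) := Q2.
have Q3ul : ulsubmx Q3 = 1%:M.
  apply/matrixP => i j; rewrite !ord1 !mxE -[RHS]Q200; congr (Q2 _ _); exact: val_inj.
set c := dlsubmx Q3; set r := ursubmx Q3; set D := drsubmx Q3.
have Q3E : Q3 = block_mx 1%:M r c D by rewrite -[LHS]submxK Q3ul.
have [A [U [d [uA uU dC d0 dE]]]] := IH n (D - c *m r).
pose d' i := if i is i'.+1 then p * d i' else p.
pose A1 := block_mx 1%:M 0 0 A *m block_mx 1%:M 0 (- c) 1%:M.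
pose U1 := block_mx 1%:M (- r) 0 1%:M *m block_mx 1%:M 0 0 U.
have E : A1 *m Q3 *m U1 = block_mx 1%:M 0 0 (smith_mx m n d).
  have step : block_mx 1%:M 0 (- c) 1%:M *m Q3 *m block_mx 1%:M (- r) 0 1%:M =
              block_mx 1%:M 0 0 (D - c *m r).
    rewrite Q3E !mulmx_block !(mul1mx, mulmx1, mul0mx, mulmx0, addr0, add0r).
    by rewrite !(addNr, subrr, mul0mx, addr0, add0r) mulNmx [- _ + D]addrC.
  rewrite /A1 /U1 -[_ *m _ *m Q3]mulmxA [_ *m (_ *m block_mx _ _ _ U)]mulmxA.
  rewrite -[block_mx _ _ _ A *m _ *m _]mulmxA step !mulmx_block.
  by rewrite !(mul1mx, mulmx1, mul0mx, mulmx0, addr0, add0r) dE.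
have E' : p *: block_mx 1%:M 0 0 (smith_mx m n d) = smith_mx (1 + m) (1 + n) d'.
  apply/matrixP => i j; rewrite !mxE; case: splitP => i' ->; rewrite !mxE;
    case: splitP => j' ->; rewrite !mxE ?ord1 ?mulr0 ?mulr1 //=.
  by rewrite eqSS mulrnAr.
have uA1 : A1 \in unitmx.
  by rewrite unitmx_mul unitmx_block_diag ?unitmx1 //= unitmxE det_lblock !det1 mulr1 unitr1.
have uU1 : U1 \in unitmx.
  by rewrite unitmx_mul unitmx_block_diag ?unitmx1 //= unitmxE det_ublock !det1 mulr1 unitr1.
exists (A1 *m tperm_mx ord0 i0), (tperm_mx ord0 j0 *m U1), d'; split.
- by rewrite unitmx_mul unitmx_perm andbT.
- by rewrite unitmx_mul unitmx_perm.
- move=> [|i] [|j] // hij; rewrite /d'; first exact: val_le_refl.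
    by rewrite mulrC; apply: val_leMl; apply: val_le_refl.
  by have [e ->] := dC i j hij; exists e; rewrite mulrCA.
- by move=> [|i]; rewrite minnSS // ltnS /= => /d0 ->; rewrite mulr0.
have -> : A1 *m tperm_mx ord0 i0 *m Q *m (tperm_mx ord0 j0 *m U1) = A1 *m Q1 *m U1.
  by rewrite /Q1 !mulmxA.
by rewrite Q2E -[RHS]E' -E -scalemxAr -scalemxAl.
Qed.

End Smith.

(** * Free quotients read off from the Smith form *)

Section SmithInvariants.
Variable R : idomainType.
Implicit Types (a b c : R) (d : nat -> R).

(** Determinants modulo a: a product through fewer than k coordinates is
    singular, and is congruent to the identity. *)
Lemma onto_free_rank m n (Q : 'M[R]_(m, n)) k a :
  (n < k)%N -> onto_free Q k a -> a \is a GRing.unit.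
Proof.
move=> nk [P [L _ /dvdmxP h]]; apply/val_le1.
have := @det_congr _ (val_le a) _ (L *m P) 1%:M (val_le0 a) (@val_leD _ a)
  (fun x y => @val_leMl _ a y x).
rewrite det1 det_mul_narrow // sub0r => h'.
rewrite -[1]opprK -mulN1r; apply/val_leMl/h' => i j.
by move: (h i j); rewrite mxE [(- 1%:M) i j]mxE.
Qed.

Lemma dvdmx_smith_mul m n p d (P : 'M_(n, p)) a (i : 'I_n) j :
  (forall i, (m <= i)%N -> d i = 0) ->
  dvdmx a (smith_mx m n d *m P) -> val_le a (d i * P i j).
Proof.
move=> d0 /dvdmxP h; have [mi|im] := leqP m i.
  by rewrite d0 // mul0r; apply: val_le0.
have := h (Ordinal im) j; rewrite mxE (bigD1 i) //= big1 ?addr0.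
  by rewrite mxE eqxx.
by move=> l li; rewrite mxE eq_sym (inj_eq val_inj) (negPf li) mul0r.
Qed.

Hypothesis hR : valuation_ring R.

(** The cokernel is the sum of the R/(d i), where later terms are closer to
    free, so a surjection onto k+1 copies of R/a must use the index t, the
    k+1-st from the end.  Conversely the last k+1 generators do.  For the
    necessity, if a does not divide d t then the first t+1 generators go to
    non-units, and modulo the maximal ideal the identity would factor through
    the k remaining ones. *)
Lemma onto_free_smith m t k d a :
  val_chain d -> (forall i, (m <= i)%N -> d i = 0) ->
  onto_free (smith_mx m (t.+1 + k) d) k.+1 a <-> val_le a (d t).
Proof.
move=> dC d0; split=> [[P [L h1 h2]]|adt]; last first.
  have fP (j : 'I_k.+1) : (t + j < t.+1 + k)%N by rewrite addSnnS ltn_add2l.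
  pose f j := Ordinal (fP j).
  have f_inj : injective f by move=> j l [/addnI/val_inj].
  exists (colsub f 1%:M), (rowsub f 1%:M).
    rewrite mulmx_colsub mulmx1; apply/dvdmxP => i j; rewrite !mxE.
    case: eqP => [/= ->|_]; last by rewrite mulr0n; apply: val_le0.
    by apply: val_le_trans adt (dC _ _ _); apply: leq_addr.
  rewrite mulmx_colsub mulmx1 (_ : _ - _ = 0); first exact: dvdmx0.
  by apply/matrixP => i j; rewrite !mxE (inj_eq f_inj) subrr.
have [//|na] := pselect (val_le a (d t)); exfalso.
have ua : a \isn't a GRing.unit by apply/negP => /(@val_le_unit _ _ (d t)).
have nonunit_le x : val_le a x -> x \isn't a GRing.unit.
  by move=> [c ->]; apply: nonunitM.
have nonunit0 : (0 : R) \isn't a GRing.unit by rewrite unitr0.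
have uP i j : usubmx P i j \isn't a GRing.unit.
  apply/negP => u; apply: na; have := @dvdmx_smith_mul _ _ _ _ _ _ (lshift k i) j d0 h1.
  rewrite mxE in u; move=> [c E]; apply: val_le_trans (dC i t _); last by rewrite -ltnS.
  exists (c / P (lshift k i) j).
  by rewrite mulrAC -E mulrK.
(* Apply the determinant congruence modulo the maximal ideal. *)
suff: (1 : R) \isn't a GRing.unit by rewrite unitr1.
have -> : 1 = \det (1%:M : 'M[R]_k.+1) - \det (rsubmx L *m dsubmx P).
  by rewrite det1 det_mul_narrow // subr0.
apply: (@det_congr _ (fun x => x \isn't a GRing.unit)) => // [x y|x y|i j].
- exact: nonunitD.
- exact: nonunitM.
have LP : L *m P = lsubmx L *m usubmx P + rsubmx L *m dsubmx P.
  by rewrite -mul_row_col hsubmxK vsubmxK.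
move/dvdmxP: h2 => /(_ i j); rewrite LP => h2.
pose x := (lsubmx L *m usubmx P) i j.
have xu : x \isn't a GRing.unit.
  rewrite /x mxE; apply: (big_ind (fun x => x \isn't a GRing.unit)) => //.
    exact: nonunitD.
  by move=> l _; apply: nonunitM.
rewrite (_ : _ - _ = x + -1 * (x + ((rsubmx L *m dsubmx P) i j) - (1%:M : 'M_k.+1) i j)).
  apply: nonunitD => //; apply: nonunitM; apply: nonunit_le.
  by move: h2; rewrite mxE [(- 1%:M) i j]mxE [X in val_le _ (X - _)]mxE.
by rewrite mulN1r -addrA opprD addNKr opprB.
Qed.

End SmithInvariants.

(** * Invariants of a matrix and of its transpose *)

Section SmithConsequences.
Variable R : idomainType.
Hypothesis hR : valuation_ring R.
Implicit Types (a b c : R) (d : nat -> R).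

Lemma onto_free_rankE m n (Q : 'M[R]_(m, n)) k a :
  (n < k)%N -> onto_free Q k a <-> val_le a 1.
Proof.
move=> nk; split=> [/(onto_free_rank nk)/val_le1//|/val_le1].
exact: onto_free_unit.
Qed.

(** The element e is the k+1-st invariant of the cokernel, counted from the
    largest. *)
Lemma onto_free_max m n (Q : 'M[R]_(m, n)) k :
  exists e, forall a, onto_free Q k.+1 a <-> val_le a e.
Proof.
have [nk|] := leqP n k; first by exists 1 => a; apply: onto_free_rankE.
move=> /subnK; rewrite addnS -addSn; move: (n - k.+1)%N => t E.
case: n / E Q => Q; have [A [U [d [uA uU dC d0 E]]]] := smith_form hR Q.
exists (d t) => a; rewrite -(onto_free_equiv Q k.+1 a uA uU) E.
apply: onto_free_smith => // i mi.
by apply: d0; rewrite geq_min mi.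
Qed.

(** Test the hypothesis with the invariants d i themselves in the role of a. *)
Lemma smith_invariants_le m n d d' :
  val_chain d -> (forall i, (minn m n <= i)%N -> d i = 0) ->
  val_chain d' -> (forall i, (minn m n <= i)%N -> d' i = 0) ->
  (forall k a, onto_free (smith_mx m n d) k a -> onto_free (smith_mx m n d') k a) ->
  forall i, val_le (d i) (d' i).
Proof.
move=> dC d0 dC' d0' H t.
have [nt|] := leqP n t; first by rewrite d0' ?geq_min ?nt ?orbT //; apply: val_le0.
move=> /subnKC; move: (n - t.+1)%N => k E; case: n / E d0 d0' H => d0 d0' H.
apply: (proj1 (@onto_free_smith R hR m t k d' _ dC' _)).
  by move=> i mi; apply: d0'; rewrite geq_min mi.
apply/H/(proj2 (@onto_free_smith R hR m t k d _ dC _)); last exact: val_le_refl.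
by move=> i mi; apply: d0; rewrite geq_min mi.
Qed.

Lemma val_eq_unit a b : val_le a b -> val_le b a ->
  exists2 u, u \is a GRing.unit & b = u * a.
Proof.
move=> [c ->] [c' E]; have [->|a0] := eqVneq a 0.
  by exists 1; rewrite ?unitr1 // !mulr0.
exists c => //; apply/unitrPr; exists c'; apply: (mulIf a0).
by rewrite mul1r [RHS]E mulrCA mulrA.
Qed.

(** For matrices of the same size, the invariants of the cokernels are those
    of the Smith forms, so equal invariants give equivalent matrices. *)
Lemma onto_free_equivalent m n (Q Q' : 'M[R]_(m, n)) :
  (forall k a, onto_free Q k a <-> onto_free Q' k a) ->
  exists A U, [/\ A \in unitmx, U \in unitmx & Q' = A *m Q *m U].
Proof.
move=> H.
have [A [U [d [uA uU dC d0 E]]]] := smith_form hR Q.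
have [A' [U' [d' [uA' uU' dC' d0' E']]]] := smith_form hR Q'.
have dd' i : val_le (d i) (d' i).
  apply: (smith_invariants_le dC d0 dC' d0') => k a.
  by rewrite -E -E' !onto_free_equiv // H.
have d'd i : val_le (d' i) (d i).
  apply: (smith_invariants_le dC' d0' dC d0) => k a.
  by rewrite -E -E' !onto_free_equiv // H.
have uP i : exists u, (u \is a GRing.unit) /\ (d' i = u * d i).
  by have [u] := val_eq_unit (dd' i) (d'd i); exists u.
pose u i := sval (cid (uP i)).
have [uu uE] : (forall i, u i \is a GRing.unit) /\ forall i, d' i = u i * d i.
  by split=> i; rewrite /u; case: (cid _) => ? [].
pose C : 'M_m := diag_mx (\row_i u i).
have uC : C \in unitmx.
  rewrite unitmxE det_diag; apply: rpred_prod => i _; by rewrite mxE.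
exists (invmx A' *m C *m A), (U *m invmx U'); split.
- by rewrite !unitmx_mul unitmx_inv uA' uC.
- by rewrite unitmx_mul unitmx_inv uU.
have -> : invmx A' *m C *m A *m Q *m (U *m invmx U') =
          invmx A' *m (C *m smith_mx m n d) *m invmx U' by rewrite -E !mulmxA.
have -> : C *m smith_mx m n d = A' *m Q' *m U'.
  rewrite E'; apply/matrixP => i j; rewrite mul_diag_mx !mxE uE.
  by rewrite mulrnAr.
by rewrite !mulmxA mulVmx // mul1mx mulmxK.
Qed.

(** Transposing the Smith form keeps the diagonal; only the number of zero
    invariants changes, by the difference of the two dimensions. *)
Lemma onto_free_tr m n (Q : 'M[R]_(m, n)) k l a :
  (k + n = l + m)%N -> onto_free Q^T k.+1 a <-> onto_free Q l.+1 a.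
Proof.
move=> kl; have [A [U [d [uA uU dC d0 E]]]] := smith_form hR Q.
rewrite -(onto_free_equiv Q _ a uA uU) E.
rewrite -(onto_free_equiv Q^T _ a (A := U^T) (U := A^T)) ?unitmx_tr //.
rewrite -mulmxA -!trmx_mul E tr_smith_mx.
have [ml|] := leqP m k.
  have nl : (n <= l)%N by rewrite -(leq_add2r m) -kl addnC leq_add2r.
  by rewrite !onto_free_rankE.
move=> /subnK; rewrite addnS -addSn; move: (m - k.+1)%N => t Em.
have En : (t.+1 + l = n)%N by apply/eqP; rewrite -(eqn_add2l k) kl -Em addnCA [(k + l)%N]addnC addnCA.
case: m / Em kl Q A uA E d0 => kl Q A uA E d0; case: n / En kl Q U uU E d0 => kl Q U uU E d0.
by rewrite !onto_free_smith // => i hi; apply: d0; rewrite geq_min hi ?orbT.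
Qed.

End SmithConsequences.

(** * Elements that split off a free summand *)

Section Splitting.
Variable R : idomainType.
Implicit Types (a b c : R) (d : nat -> R).

(** The class of x spans a free direct summand of the cokernel of Q modulo a:
    some homomorphism f to R/a sends it to 1. *)
Definition splits_off m n (Q : 'M[R]_(m, n)) (x : 'rV_n) a : Prop :=
  exists2 f : 'cV_n, dvdmx a (Q *m f) & dvdmx a (x *m f - 1%:M).

Lemma splits_off_unit m n (Q : 'M[R]_(m, n)) x a :
  a \is a GRing.unit -> splits_off Q x a.
Proof. by move=> ua; exists 0; apply: dvdmx_unit. Qed.

(** Modulo a the cokernel of Q is the sum of R/a and the cokernel of Q with
    the extra relation x, so every free quotient of the latter gains one
    summand. *)
Lemma splits_off_onto m n (Q : 'M[R]_(m, n)) (x : 'rV_n) a k :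
  splits_off Q x a -> onto_free (col_mx Q x) k a -> onto_free Q k.+1 a.
Proof.
move=> [f Qf xf] [P [L]]; rewrite mul_col_mx => /dvdmx_col[QP xP] LP.
pose P' := row_mx f P; pose L' := col_mx x (L *m (1%:M - f *m x)).
suff [h1 h2] : dvdmx a (Q *m P') /\ dvdmx a (L' *m P' - 1%:M) by exists P', L'.
split; first by rewrite mul_mx_row; apply/dvdmx_row.
rewrite mul_col_row scalar_mx_block opp_block_mx add_block_mx !oppr0 !addr0.
have Lf : dvdmx a (L *m (1%:M - f *m x) *m f).
  rewrite -mulmxA mulmxBl mul1mx -mulmxA -{1}[f]mulmx1 -mulmxBr -opprB mulmxN.
  by rewrite mulmxN; apply/dvdmxN/dvdmx_mull/dvdmx_mull.
have LQ : dvdmx a (L *m (1%:M - f *m x) *m P - 1%:M).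
  rewrite mulmxBr mulmxBl mulmx1 addrAC; apply: dvdmxB => //.
  by rewrite !mulmxA -mulmxA; apply: dvdmx_mull.
by apply/dvdmx_col; split; apply/dvdmx_row.
Qed.

Lemma splits_off_trans b a m n (Q : 'M[R]_(m, n)) x :
  val_le a b -> splits_off Q x b -> splits_off Q x a.
Proof. by move=> ab [f h1 h2]; exists f; apply: dvdmx_trans ab _. Qed.

Lemma downclosed_threshold (P : nat -> Prop) n :
  (forall i j, (i <= j)%N -> P j -> P i) ->
  exists t, [/\ (t <= n)%N, forall i, (i < t)%N -> P i &
                forall i, (t <= i < n)%N -> ~ P i].
Proof.
move=> down; elim: n => [|n [t [tn h1 h2]]].
  by exists 0%N; split=> // i; rewrite andbC.
have [Pn|nPn] := pselect (P n).
  by exists n.+1; split=> // i; [rewrite ltnS => /down; apply | rewrite ltnS andbC ltnNge andbN].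
exists t; split=> // [|i /andP[ti]]; first exact: leqW.
by rewrite ltnS leq_eqVlt => /predU1P[->//|ik]; apply: h2; rewrite ti.
Qed.

Hypothesis hR : valuation_ring R.

(** Suppose that x does not split off.  Let e be the largest invariant d j at
    which x has a unit coordinate (e = 1 if there is none); then a does not
    divide e.  Choose c strictly above e in value, but at most a, at most
    every invariant above e, and so close to e that c divides e * x j at the
    corresponding coordinates.  The h generators with invariant above e still
    map onto h copies of R/c after x is killed: subtracting a multiple of the
    unit coordinate (the vector g below) makes the map vanish on x.
    By hypothesis the original cokernel then surjects onto h+1 copies, so c
    divides one more invariant (or is a unit, if there is none left); but the
    remaining invariants divide e, and so would c. *)
Lemma onto_splits_off_smith m n d (x : 'rV[R]_n) a :
  val_chain d -> (forall i, (m <= i)%N -> d i = 0) ->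
  (forall c k, val_le c a -> onto_free (col_mx (smith_mx m n d) x) k c ->
     onto_free (smith_mx m n d) k.+1 c) ->
  splits_off (smith_mx m n d) x a.
Proof.
move=> dC d0 H; have [//|nS] := pselect (splits_off (smith_mx m n d) x a).
exfalso.
have Dcol j b : dvdmx (d (j : 'I_n)) (smith_mx m _ d *m (b *: delta_mx j 0 : 'cV_n)).
  rewrite -scalemxAr -colE; apply/dvdmxP => i l; rewrite !mxE; apply: val_leMl.
  case: eqP => [->|_]; [exact: val_le_refl | exact: val_le0].
have na j : x 0 j \is a GRing.unit -> ~ val_le a (d j).
  move=> ux aj; apply: nS; exists ((x 0 j)^-1 *: delta_mx j 0).
    exact: dvdmx_trans (Dcol _ _).
  rewrite -scalemxAr -colE (_ : _ - _ = 0); first exact: dvdmx0.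
  by apply/matrixP => i l; rewrite !ord1 !mxE mulVr // subrr.
have [g [e [nae eg gx g0 xg]]] : exists (g : 'cV[R]_n) e, [/\ ~ val_le a e,
    dvdmx e (smith_mx m _ d *m g),
    forall j : 'I_n, ~ val_le (d j) e -> x 0 j \isn't a GRing.unit,
    forall j : 'I_n, ~ val_le (d j) e -> g j 0 = 0 &
    x *m g = 1%:M \/ g = 0 /\ e = 1].
  case: (pickP (fun j => x 0 j \is a GRing.unit)) => [j1 uj1|J0].
    case: (@arg_maxnP _ j1 (fun j => x 0 j \is a GRing.unit) (@nat_of_ord n) uj1) => j0 uj0 j0max.
    exists ((x 0 j0)^-1 *: delta_mx j0 0), (d j0); split=> //.
    - exact: na.
    - by move=> j nj; apply/negP => /j0max/dC.
    - move=> j nj; rewrite !mxE; case: eqP => [E|_]; last by rewrite mulr0.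
      by case: nj; rewrite E; apply: val_le_refl.
    left; rewrite -scalemxAr -colE; apply/matrixP => i l.
    by rewrite !ord1 !mxE mulVr.
  exists 0, 1; split=> //.
  - by move=> /val_le1 ua; apply: nS; apply: splits_off_unit.
  - by rewrite mulmx0; apply: dvdmx0.
  - by move=> j _; rewrite J0.
  - by move=> j _; rewrite mxE.
  - by right.
have [|t [tn lt_t ge_t]] := @downclosed_threshold (fun i => val_le (d i) e) n.
  by move=> i j ij; apply: val_le_trans (dC i j ij).
move: tn => /subnKC; move: (n - t)%N => h En; case: n / En x H nS Dcol na g eg gx g0 xg ge_t.
move=> x H nS Dcol na g eg gx g0 xg ge_t.
(* The values below which c has to lie; none of them divides e. *)
pose s := a :: codom (fun j : 'I_h => d (rshift t j)) ++
               codom (fun j : 'I_h => e * x 0 (rshift t j)).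
have [|||c cs cmin] := @total_preorder_min _ (@val_le R) s.
- exact: val_le_total.
- exact: val_le_trans.
- by [].
have nd (j : 'I_h) : ~ val_le (d (rshift t j)) e.
  by apply: ge_t; rewrite /= leq_addr ltn_add2l ltn_ord.
have nce : ~ val_le c e.
  have e0 : e != 0 by apply: contra_notN nae => /eqP->; apply: val_le0.
  move: cs; rewrite inE mem_cat => /or3P[/eqP->//|/codomP[j ->]//|/codomP[j ->]].
  move=> [z]; rewrite mulrCA -{1}[e]mulr1 => /(mulfI e0) /esym zx.
  have /negP := gx _ (nd j); apply; apply/unitrPr; exists z.
  by rewrite mulrC.
have ca : val_le c a by apply: cmin; rewrite mem_head.
have cd (j : 'I_h) : val_le c (d (rshift t j)).
  apply: cmin; rewrite inE mem_cat; apply/or3P/Or32.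
  exact: (codom_f (fun j : 'I_h => d (rshift t j))).
have cx (j : 'I_h) : val_le c (e * x 0 (rshift t j)).
  apply: cmin; rewrite inE mem_cat; apply/or3P/Or33.
  exact: (codom_f (fun j : 'I_h => e * x 0 (rshift t j))).
have : onto_free (col_mx (smith_mx m _ d) x) h c.
  exists (col_mx 0 1%:M - g *m rsubmx x), (row_mx 0 1%:M).
    rewrite mul_col_mx; apply/dvdmx_col; split.
      rewrite mulmxBr mulmxA; apply: dvdmxB.
        apply/dvdmxP => i j; rewrite -[smith_mx m _ d]hsubmxK mul_row_col.
        rewrite mulmx0 add0r mulmx1 !mxE.
        have [->|_] := eqVneq (i : nat) (rshift t j : nat); first exact: cd.
        exact: val_le0.
      have [Z ->] := eg; apply/dvdmxP => i j.
      by rewrite mxE big_ord1 !mxE mulrAC mulrC; apply: val_leMl; apply: cx.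
    rewrite mulmxBr mulmxA -{1}[x]hsubmxK mul_row_col mulmx0 add0r mulmx1.
    case: xg => [->|[-> e1]]; first by rewrite mul1mx subrr; apply: dvdmx0.
    rewrite mulmx0 mul0mx subr0; apply/dvdmxP => i j; rewrite ord1 mxE.
    by rewrite -[x _ _]mul1r -e1.
  rewrite mulmxBr mulmxA mul_row_col mul0mx add0r mulmx1 -{1}[g]vsubmxK mul_row_col.
  rewrite mul0mx add0r mul1mx (_ : dsubmx g = 0) ?mul0mx ?subr0 ?subrr; first exact: dvdmx0.
  by apply/matrixP => i j; rewrite ord1 !mxE; apply: g0; apply: nd.
move=> /(H c h ca); case: (t) lt_t => [|t'] lt_t'.
  by move=> /onto_free_rank -/(_ (ltnSn _)) /(@val_le_unit _ _ e).
move=> /(proj1 (@onto_free_smith R hR m t' h d c dC d0)) cdt.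
by apply: nce; apply: val_le_trans cdt (lt_t' _ _).
Qed.

(** Together with the previous direction this characterizes splitting off by
    the isomorphism types of the two cokernels, so it does not depend on the
    element x chosen to present the quotient. *)
Lemma onto_splits_off m n (Q : 'M[R]_(m, n)) (x : 'rV_n) a :
  (forall c k, val_le c a -> onto_free (col_mx Q x) k c -> onto_free Q k.+1 c) ->
  splits_off Q x a.
Proof.
move=> H; have [A [U [d [uA uU dC d0 E]]]] := smith_form hR Q.
have [|c k ca|f Df xf] := @onto_splits_off_smith m n d (x *m U) a dC.
- by move=> i hi; apply: d0; rewrite geq_min hi.
- rewrite -E onto_free_equiv // => h; apply: H => //.
  rewrite -(onto_free_equiv _ _ _ (unitmx_block_diag uA (unitmx1 _ 1)) uU).
  by rewrite mul_block_col mul0mx addr0 mul0mx add0r mul1mx mul_col_mx.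
exists (U *m f); last by rewrite mulmxA.
have -> : Q *m (U *m f) = invmx A *m (smith_mx m n d *m f).
  by rewrite -E !mulmxA mulVmx // mul1mx.
exact: dvdmx_mull.
Qed.

End Splitting.

(** * The augmentation lemma *)

Section Families.
Variables (R : idomainType) (E : finType).
Implicit Types (a b c : R) (A : {set E}).

(** In the families s below, s A k a stands for the existence of a surjection
    from the module at A onto k copies of R/a. *)
Definition represents m n (Q : 'M[R]_(m, n)) (s : nat -> R -> Prop) : Prop :=
  forall k a, s k a <-> onto_free Q k a.

Variable s : {set E} -> nat -> R -> Prop.

(** The local axioms of a matroid over R, remembering of each module only its
    free quotients. *)
Definition one_step : Prop := forall A (e : E), e \notin A ->
  exists m n (Q : 'M_(m, n)) (x : 'rV_n),
    represents Q (s A) /\ represents (col_mx Q x) (s (e |: A)).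

Definition two_steps : Prop := forall A (e f : E),
  e \notin A -> f \notin A -> e != f ->
  exists m n (Q : 'M_(m, n)) (x y : 'rV_n),
    [/\ represents Q (s A), represents (col_mx Q x) (s (e |: A)),
        represents (col_mx Q y) (s (f |: A)) &
        represents (col_mx (col_mx Q x) y) (s (f |: (e |: A)))].

(** The isomorphism-invariant form of the statement that the element of M(A)
    killed in M(A u e) splits off modulo a. *)
Definition splitting A (e : E) a : Prop :=
  forall c k, val_le c a -> s (e |: A) k c -> s A k.+1 c.

Hypothesis hR : valuation_ring R.

Lemma mx11_invZ (X : 'M[R]_1) : X 0 0 \is a GRing.unit -> (X 0 0)^-1 *: X = 1%:M.
Proof. by move=> u; apply/matrixP => i j; rewrite !ord1 !mxE mulVr. Qed.

Lemma val_gcd a b : exists g, [/\ val_le g a, val_le g b & g = a \/ g = b].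
Proof.
by have [ab|ba] := val_le_total hR a b; [exists a | exists b];
  split=> //; [apply: val_le_refl|left|apply: val_le_refl|right].
Qed.

Hypotheses (step1 : one_step) (step2 : two_steps).
Hypothesis s_top : forall a, s setT 1 a -> a \is a GRing.unit.

(** The substitute for Nakayama's lemma, valid for families that are only
    locally realizable. *)
Lemma exists_splitting A a : a \isn't a GRing.unit -> s A 1 a ->
  exists2 e, e \notin A & splitting A e a.
Proof.
move: {2}#|~: A| (leqnn #|~: A|) => N; elim: N A a => [|N IH] A a hN ua sA.
  move: hN; rewrite leqn0 cards_eq0 => /eqP A0.
  have AT : A = setT by rewrite -[A]setCK A0 setC0.
  by move: ua; rewrite (s_top _) // -AT.
have [//|nosplit] := pselect (exists2 e, e \notin A & splitting A e a); exfalso.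
have no_split m n (Q : 'M_(m, n)) x e : e \notin A -> represents Q (s A) ->
    represents (col_mx Q x) (s (e |: A)) -> ~ splits_off Q x a.
  move=> eA rA reA sp; apply: nosplit; exists e => // c k ca.
  by move=> /reA h; apply/rA/(splits_off_onto (splits_off_trans ca sp)).
have value_nonunit m n (Q : 'M_(m, n)) (x : 'rV_n) e (h : 'cV_n) : e \notin A ->
    represents Q (s A) -> represents (col_mx Q x) (s (e |: A)) ->
    dvdmx a (Q *m h) -> (x *m h) 0 0 \isn't a GRing.unit.
  move=> eA rA reA Qh; apply/negP => up; apply: (no_split m n Q x e eA rA reA).
  exists (((x *m h) 0 0)^-1 *: h).
    by rewrite -scalemxAr -mul_scalar_mx; apply: dvdmx_mull.
  by rewrite -scalemxAr mx11_invZ // subrr; apply: dvdmx0.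
have A0 : enum (~: A) != [::].
  apply/eqP => A0; have AT : A = setT.
    by apply/setP => e; rewrite inE -[e \in A]negbK -in_setC -mem_enum A0.
  by move: ua; rewrite (s_top _) // -AT.
(* v is the largest divisor of a such that M(A u e) has a quotient R/v. *)
have vex e : exists v, e \notin A -> [/\ val_le v a, s (e |: A) 1 v &
    forall c, val_le c a -> s (e |: A) 1 c -> val_le c v].
  have [eA|eA] := boolP (e \in A); first by exists 0.
  have [m [n [Q [x [_ reA]]]]] := step1 eA.
  have [z zP] := onto_free_max hR (col_mx Q x) 0.
  have [v [va vz vE]] := val_gcd a z; exists v => _; split=> //.
    exact/reA/zP.
  by move=> c ca /reA/zP cz; case: vE => ->.
pose v e := sval (cid (vex e)).
have vP e : e \notin A -> [/\ val_le (v e) a, s (e |: A) 1 (v e) &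
    forall c, val_le c a -> s (e |: A) 1 c -> val_le c (v e)].
  by rewrite /v; case: (cid _).
have [|||e eA emax] :=
    @total_preorder_min _ (fun e f => val_le (v f) (v e)) (enum (~: A)).
- by move=> e f; apply: val_le_total.
- by move=> e f g ? /val_le_trans; apply.
- by [].
rewrite mem_enum inE in eA; have [va sv vmax] := vP e eA.
have {}emax f : f \notin A -> val_le (v f) (v e).
  by move=> fA; apply: emax; rewrite mem_enum inE.
(* The image p of x under a surjection onto R/a is a non-unit, so R/gcd(a, p)
   is a nonzero quotient of the module at e |: A. *)
have uv : v e \isn't a GRing.unit.
  have [m [n [Q [x [rA reA]]]]] := step1 eA.
  have /rA[P [L QP LP]] := sA.
  have px := value_nonunit _ _ _ _ _ P eA rA reA QP.
  have [g [ga gp gE]] := val_gcd a ((x *m P) 0 0).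
  have gv : val_le g (v e).
    apply: vmax => //; apply/reA; exists P, L; last exact: dvdmx_trans ga _.
    rewrite mul_col_mx; apply/dvdmx_col; split; first exact: dvdmx_trans ga _.
    by apply/dvdmxP => i j; rewrite !ord1.
  apply/negP => /val_le_unitP/(_ gv) ug.
  by case: gE => gE; [move: ua | move: px]; rewrite -gE ug.
have [f feA spl] : exists2 f, f \notin e |: A & splitting (e |: A) f (v e).
  apply: IH => //; rewrite -ltnS; apply: leq_trans hN.
  by apply: proper_card; rewrite setCU setIC; apply/properP; split;
    [apply: subsetIl | exists e; rewrite !inE ?eA ?eqxx].
move: feA; rewrite !inE negb_or eq_sym => /andP[ef fA].
have [m [n [Q [x [y [rA reA rfA refA]]]]]] := step2 eA fA ef.
have [|h] := @onto_splits_off _ hR _ _ (col_mx Q x) y (v e).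
  by move=> c k cv /refA hc; apply/reA/(spl c k cv).
rewrite mul_col_mx => /dvdmx_col[Qh xh] yh.
have nav : ~ val_le a (v e).
  by move=> av; apply: (no_split _ _ _ _ _ fA rA rfA); exists h; apply: dvdmx_trans av _.
have /rA[P [L QP LP]] := sA.
have py := value_nonunit _ _ _ _ _ P fA rA rfA QP.
set p := (y *m P) 0 0 in py.
have [g [ga gp gE]] := val_gcd a (v e * p).
(* t is the modified surjection: defined modulo g, zero on y. *)
have gv : val_le g (v e).
  apply: val_le_trans (emax f fA); have [_ _ fmax] := vP f fA; apply: fmax => //.
  apply/rfA; pose t := P - p *: h.
  have ut : (L *m t) 0 0 \is a GRing.unit.
    apply/negPn/negP => nu; suff: (1 : R) \isn't a GRing.unit by rewrite unitr1.
    have -> : 1 = (L *m t) 0 0 + (-1 * (L *m P - 1%:M) 0 0 + (L *m h) 0 0 * p).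
      have subE (X Y : 'M[R]_1) : (X - Y) 0 0 = X 0 0 - Y 0 0 by rewrite !mxE.
      have scaleE c (X : 'M[R]_1) : (c *: X) 0 0 = c * X 0 0 by rewrite mxE.
      have oneE : (1%:M : 'M[R]_1) 0 0 = 1 by rewrite mxE eqxx.
      rewrite /t mulmxBr -scalemxAr !subE scaleE oneE.
      move: ((L *m P) 0 0) ((L *m h) 0 0) => u w.
      by rewrite mulN1r opprB [p * w]mulrC addrACA addNr addr0 addrC subrK.
    apply: (nonunitD hR) => //; apply: (nonunitD hR); last exact: nonunitM.
    apply: nonunitM; have /dvdmxP/(_ 0 0) [c ->] := LP; exact: nonunitM.
  exists t, (((L *m t) 0 0)^-1 *: L); last first.
    by rewrite -scalemxAl mx11_invZ // subrr; apply: dvdmx0.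
  rewrite mul_col_mx; apply/dvdmx_col; split.
    rewrite mulmxBr -scalemxAr; apply: dvdmxB; first exact: dvdmx_trans ga _.
    exact: dvdmx_scale gp _.
  rewrite mulmxBr -scalemxAr [y *m P]mx11_scalar -/p -scalemx1 -scalerBr -opprB scalerN.
  by apply: dvdmxN; apply: dvdmx_scale gp _.
(* A divisor g of v e equal to v e * p forces p to be a unit. *)
case: gE => gE; first by apply: nav; rewrite -gE.
move: gv; rewrite gE => -[z]; rewrite mulrCA -{1}[v e]mulr1 => h1.
have v0 : v e != 0 by apply: contra_notN nav => /eqP->; apply: val_le0.
move/negP: py; apply; apply/unitrPr; exists z.
by rewrite mulrC -(mulfI v0 h1).
Qed.

End Families.

(** * Recursion on families, and presentations of modules *)

Section FamilyRecursion.
Variables (R : idomainType) (E : finType) (s : {set E} -> nat -> R -> Prop).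
Implicit Types (A : {set E}) (a : R).
Hypothesis hR : valuation_ring R.
Hypotheses (step1 : one_step s) (step2 : two_steps s).
Hypothesis s_top : forall a, s setT 1 a -> a \is a GRing.unit.

Lemma family_contract A e k a : e \notin A -> s A k.+1 a -> s (e |: A) k a.
Proof.
move=> /step1[m [n [Q [x [rA reA]]]]] /rA h.
exact/reA/onto_free_row.
Qed.

Lemma family_mono A e k a : e \notin A -> s (e |: A) k a -> s A k a.
Proof. by move=> /step1[m [n [Q [x [rA reA]]]]] /reA/onto_free_col/rA. Qed.

(** If the module at A has a quotient R/a, the splitting element turns the
    k+1 copies of R/a at one larger set into k+2 copies at A.  If it has none,
    neither does any larger set, so the hypothesis fails. *)
Lemma family_extend A k a : A != setT ->
  (forall e, e \notin A -> s (e |: A) k.+1 a) -> s A k.+2 a.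
Proof.
rewrite -subTset => /subsetPn[e _ eA] h.
have [m [n [Q [x [rA _]]]]] := step1 eA.
have [ua|na] := boolP (a \is a GRing.unit); first exact/rA/onto_free_unit.
have sA : s A 1 a.
  by have /rA/(@onto_free_le _ _ _ _ 1 k.+1 _ isT)/rA := family_mono eA (h e eA).
have [f fA spl] := exists_splitting hR step1 step2 s_top na sA.
exact: spl (val_le_refl a) (h f fA).
Qed.

End FamilyRecursion.

Section Presentations.
Variable R : idomainType.
Implicit Types (N : lmodType R).

Definition presents N m n (Q : 'M[R]_(m, n)) : Prop :=
  exists2 g : {linear 'rV[R]_n -> N}, (forall y, exists v, g v = y) &
    forall v, g v = 0 <-> exists u, v = u *m Q.

(** Free modules are projective. *)
Lemma lift_linear n p N (g : {linear 'rV[R]_n -> N}) (h : {linear 'rV[R]_p -> N}) :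
  (forall y, exists v, h v = y) -> exists F, forall v, h (v *m F) = g v.
Proof.
move=> hsurj; pose w i := sval (cid (hsurj (g (delta_mx 0 i)))).
exists (\matrix_i w i) => v; rewrite mulmx_sum_row {2}[v]row_sum_delta !linear_sum.
by apply: eq_bigr => i _; rewrite !linearZ rowK /= /w; case: (cid _) => /= ? ->.
Qed.

Lemma factor_rows m n p (X : 'M[R]_(p, n)) (Q : 'M_(m, n)) :
  (forall u : 'rV_p, exists w, u *m X = w *m Q) -> exists Z, X = Z *m Q.
Proof.
move=> h; exists (\matrix_i sval (cid (h (delta_mx 0 i)))).
by apply/row_matrixP => i; rewrite row_mul rowK rowE; case: (cid _).
Qed.

(** Two presentations of one module are related by lifting the identity in
    both directions; the composites are the identity modulo the relations. *)
Lemma presents_onto N m n p q (Q : 'M[R]_(m, n)) (Q' : 'M_(p, q)) k a :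
  presents N Q -> presents N Q' -> onto_free Q k a -> onto_free Q' k a.
Proof.
move=> [g gs gk] [h hs hk] [P [L QP LP]].
have [F hF] := lift_linear g hs; have [G gG] := lift_linear h gs.
have [Z ZE] : exists Z, F *m G - 1%:M = Z *m Q.
  apply: factor_rows => u; apply/gk; rewrite mulmxBr mulmx1 mulmxA linearB /=.
  by rewrite gG hF subrr.
have [Y YE] : exists Y, Q' *m G = Y *m Q.
  by apply: factor_rows => u; apply/gk; rewrite mulmxA gG; apply/hk; exists u.
exists (G *m P), (L *m F).
  by rewrite mulmxA YE -mulmxA; apply: dvdmx_mull.
have -> : L *m F *m (G *m P) - 1%:M = L *m (Z *m (Q *m P)) + (L *m P - 1%:M).
  by rewrite [Z *m _]mulmxA -ZE mulmxBl mul1mx mulmxBr !mulmxA addrA subrK.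
by apply: dvdmxD => //; apply/dvdmx_mull/dvdmx_mull.
Qed.

Definition onto_module N k a : Prop :=
  exists m n (Q : 'M[R]_(m, n)), presents N Q /\ onto_free Q k a.

Lemma presents_represents N m n (Q : 'M[R]_(m, n)) :
  presents N Q -> represents Q (onto_module N).
Proof.
move=> pQ k a; split=> [[p [q [Q' [pQ' h]]]]|h]; last by exists m, n, Q.
exact: presents_onto pQ' pQ h.
Qed.

Lemma linear_of_prop (U V : lmodType R) (f : U -> V) : linear f ->
  exists g : {linear U -> V}, g =1 f.
Proof.
move=> f_lin; pose f_isl := GRing.isLinear.Build R U V *:%R f f_lin.
by pose g : {linear U -> V} := HB.pack f f_isl; exists g.
Qed.

Lemma lmod_iso_sym (U V : lmodType R) : lmod_iso U V -> lmod_iso V U.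
Proof.
move=> [f [f' fK f'K]].
have [|g gE] := @linear_of_prop V U f'.
  by move=> a u v; apply: (can_inj fK); rewrite linearP /= !f'K.
by exists g; exists f => x; rewrite gE.
Qed.

Lemma lmod_iso_trans (U V W : lmodType R) :
  lmod_iso U V -> lmod_iso V W -> lmod_iso U W.
Proof.
move=> [f [f' fK f'K]] [g [g' gK g'K]].
have [|h hE] := @linear_of_prop U W (g \o f).
  by move=> c u v /=; rewrite !linearP.
by exists h; exists (f' \o g') => x; rewrite hE /= ?gK ?fK ?f'K ?g'K.
Qed.

Lemma presents_iso (U V : lmodType R) m n (Q : 'M[R]_(m, n)) :
  lmod_iso U V -> presents U Q -> presents V Q.
Proof.
move=> [f [f' fK f'K]] [g gs gk].
have [|h hE] := @linear_of_prop _ V (f \o g); first by move=> a u v /=; rewrite !linearP.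
exists h => [y|v]; first by have [v gv] := gs (f' y); exists v; rewrite hE /= gv.
rewrite hE /= -gk; split=> [|->]; last by rewrite linear0.
by move=> fg; apply: (can_inj fK); rewrite fg linear0.
Qed.

Lemma presents_unique (U V : lmodType R) m n (Q : 'M[R]_(m, n)) :
  presents U Q -> presents V Q -> lmod_iso U V.
Proof.
move=> [g gs gk] [h hs hk].
have same u v : g u = g v <-> h u = h v.
  have eq0 (W : lmodType R) (f : {linear 'rV[R]_n -> W}) : f u = f v <-> f (u - v) = 0.
    by rewrite linearB /=; split=> [->|/eqP]; rewrite ?subrr // subr_eq0 => /eqP.
  by rewrite !eq0 gk hk.
pose w y := sval (cid (gs y)); have wK y : g (w y) = y by rewrite /w; case: (cid _).
pose w' y := sval (cid (hs y)); have wK' y : h (w' y) = y by rewrite /w'; case: (cid _).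
have [|f fE] := @linear_of_prop U V (h \o w).
  move=> a x y /=; rewrite -linearP; apply/same.
  by rewrite linearP !wK.
exists f; exists (g \o w') => x; rewrite /= fE /=.
  by rewrite -[RHS]wK; apply/same; rewrite wK'.
by rewrite -[RHS]wK'; apply/same; rewrite wK.
Qed.

Lemma presents_equiv N m n (Q : 'M[R]_(m, n)) A U :
  A \in unitmx -> U \in unitmx -> presents N Q -> presents N (A *m Q *m U).
Proof.
move=> uA uU [g gs gk].
have [|h hE] := @linear_of_prop _ N (fun v => g (v *m invmx U)).
  by move=> a u v; rewrite mulmxDl -scalemxAl linearP.
exists h => [y|v]; first by have [v <-] := gs y; exists (v *m U); rewrite hE mulmxK.
rewrite hE gk; split=> [[u uE]|[u ->]]; last first.
  by exists (u *m A); rewrite !mulmxA mulmxK.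
exists (u *m invmx A); rewrite !mulmxA mulmxKV // -uE.
by rewrite mulmxKV.
Qed.

Lemma quomod_proj_linear (V : lmodType R) (xs : seq V) : linear (@quomod_proj R V xs).
Proof. by move=> a u v; rewrite quomod_projD -quomod_scale_proj. Qed.

Lemma quomod_proj_eq0 (V : lmodType R) (xs : seq V) v :
  quomod_proj xs v = 0 <-> v \in span_mem xs.
Proof.
have [p pE] := linear_of_prop (@quomod_proj_linear V xs).
rewrite -pE -(linear0 p) !pE; split=> [/quomod_projP|h].
  by rewrite subr0.
by apply/quomod_projP; rewrite subr0.
Qed.

Lemma presents_quomod N (xs : seq N) m n (Q : 'M[R]_(m, n))
    (g : {linear 'rV[R]_n -> N}) :
  (forall y, exists v, g v = y) ->
  (forall v, g v \in span_mem xs <-> exists u, v = u *m Q) ->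
  presents (quomod xs) Q.
Proof.
move=> gs gk; have [p pE] := linear_of_prop (@quomod_proj_linear N xs).
have [|h hE] := @linear_of_prop _ (quomod xs) (p \o g).
  by move=> a u v /=; rewrite !linearP.
exists h => [y|v]; last by rewrite hE /= pE quomod_proj_eq0.
by have [v gv] := gs (repr (y : Quotient.quot _)); exists v; rewrite hE /= pE gv quomod_reprK.
Qed.

End Presentations.

(** * The two families attached to a matroid *)

Section QuotientPresentations.
Variable R : idomainType.
Implicit Types (N : lmodType R).

Lemma span_mem1 N (x v : N) : v \in span_mem [:: x] <-> exists c, v = c *: x.
Proof.
split=> [/span_memP[c ->]|[c ->]].
  by exists (c ord0); rewrite big_ord_recl big_ord0 addr0.
by apply/span_memP; exists (fun=> c); rewrite big_ord_recl big_ord0 addr0.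
Qed.

Lemma span_mem2 N (x y v : N) :
  v \in span_mem [:: x; y] <-> exists c d, v = c *: x + d *: y.
Proof.
split=> [/span_memP[c ->]|[c [d ->]]].
  by exists (c ord0), (c (lift ord0 ord0)); rewrite !big_ord_recl big_ord0 addr0.
apply/span_memP; exists (fun i => if i == ord0 then c else d).
by rewrite !big_ord_recl big_ord0 addr0.
Qed.

(** Both elements are lifted through one presentation of N, so the three
    quotients of a square are presented by adding rows to the same matrix. *)
Lemma presents_quotients N m n (Q : 'M[R]_(m, n)) (x y : N) :
  presents N Q -> exists x' y' : 'rV_n,
    [/\ presents (quomod [:: x]) (col_mx Q x'), presents (quomod [:: y]) (col_mx Q y') &
        presents (quomod [:: x; y]) (col_mx (col_mx Q x') y')].
Proof.
move=> [g gs gk]; have [x' <-] := gs x; have [y' <-] := gs y.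
have mem1 z v : g v \in span_mem [:: g z] <-> exists u, v = u *m col_mx Q z.
  split=> [/span_mem1[c gv]|[u ->]].
    have [|w vE] := (gk (v - c *: z)).1; first by rewrite linearB linearZ gv subrr.
    exists (row_mx w c%:M); rewrite mul_row_col -vE mul_scalar_mx.
    by rewrite subrK.
  rewrite -[u]hsubmxK mul_row_col [rsubmx u]mx11_scalar mul_scalar_mx linearD /=.
  rewrite (gk (lsubmx u *m Q)).2; last by exists (lsubmx u).
  by rewrite add0r linearZ; apply/span_mem1; exists (rsubmx u 0 0).
exists x', y'; split; apply: (presents_quomod gs) => v; [exact: mem1..|].
split=> [/span_mem2[c [d gv]]|[u ->]].
  have [|w vE] := (mem1 x' (v - d *: y')).1.
    by apply/span_mem1; exists c; rewrite linearB linearZ gv addrK.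
  by exists (row_mx w d%:M); rewrite mul_row_col -vE mul_scalar_mx subrK.
rewrite -[u]hsubmxK mul_row_col [rsubmx u]mx11_scalar mul_scalar_mx linearD /=.
have /span_mem1[c ->] : g (lsubmx u *m col_mx Q x') \in span_mem [:: g x'].
  by apply/mem1; exists (lsubmx u).
by rewrite linearZ; apply/span_mem2; exists c, (rsubmx u 0 0).
Qed.

End QuotientPresentations.

Section Elimination.
Variable R : idomainType.

(** Relations that are part of a basis (the rows of K) can be removed together
    with the generators that they kill; J, J', K, K' are the inclusions and
    projections of the resulting decomposition. *)
Lemma onto_free_eliminate r p q t (W : 'M[R]_(r, p)) (K : 'M_(q, p))
    (J : 'M_(t, p)) (J' : 'M_(p, t)) (K' : 'M_(p, q)) k a :
  J *m J' = 1%:M -> K *m J' = 0 -> J' *m J + K' *m K = 1%:M ->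
  onto_free (col_mx W K) k a <-> onto_free (W *m J') k a.
Proof.
move=> JJ KJ JK; split=> [[P [L]]|[P [L WP LP]]]; last first.
  exists (J' *m P), (L *m J); last by rewrite mulmxA -[L *m J *m J']mulmxA JJ mulmx1.
  rewrite mul_col_mx !mulmxA KJ mul0mx; apply/dvdmx_col; split=> //.
  exact: dvdmx0.
rewrite mul_col_mx => /dvdmx_col[WP KP] LP.
have JE : J' *m J *m P = P - K' *m (K *m P).
  by rewrite mulmxA -{2}[P]mul1mx -JK mulmxDl addrK.
exists (J *m P), (L *m J').
  rewrite -mulmxA [J' *m _]mulmxA JE mulmxBr; apply: dvdmxB => //.
  by apply/dvdmx_mull/dvdmx_mull.
rewrite -mulmxA [J' *m _]mulmxA JE mulmxBr addrAC; apply: dvdmxB => //.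
by apply/dvdmx_mull/dvdmx_mull.
Qed.

Lemma eliminate_last r m (W : 'M[R]_(r, m)) (y : 'cV_r) k a :
  onto_free (col_mx (row_mx W y) (row_mx 0 1%:M)) k a <-> onto_free W k a.
Proof.
rewrite (@onto_free_eliminate _ _ _ _ _ _ (row_mx 1%:M 0) (col_mx 1%:M 0) (col_mx 0 1%:M)).
- by rewrite mul_row_col mulmx1 mulmx0 addr0.
- by rewrite mul_row_col mulmx1 mul0mx addr0.
- by rewrite mul_row_col mulmx0 mul0mx addr0.
rewrite !mul_col_row !(mulmx1, mulmx0, mul0mx) add_block_mx !(addr0, add0r).
by rewrite -scalar_mx_block.
Qed.

Lemma eliminate_middle r m (W : 'M[R]_(r, m)) (x y : 'cV_r) k a :
  onto_free (col_mx (row_mx (row_mx W x) y) (row_mx (row_mx 0 1%:M) 0)) k a <->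
  onto_free (row_mx W y) k a.
Proof.
pose e := row_mx 1%:M 0 : 'M[R]_(m, m + 1).
pose z := row_mx 0 1%:M : 'M[R]_(1, m + 1).
have ee : e *m e^T = 1%:M.
  by rewrite tr_row_mx mul_row_col trmx1 trmx0 mulmx1 mul0mx addr0.
have ze : z *m e^T = 0.
  by rewrite tr_row_mx mul_row_col trmx1 trmx0 mulmx1 mulmx0 addr0.
have ez : e^T *m e + z^T *m z = 1%:M.
  rewrite !tr_row_mx !mul_col_row !trmx1 !trmx0 !(mulmx1, mulmx0, mul0mx) add_block_mx.
  by rewrite !(addr0, add0r) -scalar_mx_block.
rewrite (@onto_free_eliminate _ _ _ _ _ _ (block_mx e 0 0 1%:M)
  (block_mx e^T 0 0 1%:M) (col_mx z^T 0)).
- rewrite mul_row_block !(mulmx1, mulmx0, mul0mx) !(addr0, add0r).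
  by rewrite tr_row_mx mul_row_col trmx1 trmx0 mulmx1 mulmx0 addr0.
- by rewrite mulmx_block !(mulmx1, mulmx0, mul0mx) !(addr0, add0r) ee -scalar_mx_block.
- by rewrite mul_row_block !(mulmx1, mulmx0, mul0mx) !(addr0, add0r) ze row_mx0.
rewrite mulmx_block mul_col_row !(mulmx1, mulmx0, mul0mx) !(addr0, add0r).
by rewrite add_block_mx !(addr0, add0r) ez -scalar_mx_block.
Qed.

End Elimination.

Section MatroidFamilies.
Variables (R : idomainType) (E : finType) (M : matroid R E) (r : nat).
Hypothesis hR : valuation_ring R.
Hypothesis M0 : lmod_iso (M set0) 'rV[R]_r.
Hypothesis M_top : spannable M.
Implicit Types (A B : {set E}) (a : R).

Definition primal A := onto_module (M A).

Lemma presents_extend A (e f : E) m n (Q : 'M[R]_(m, n)) : presents (M A) Q ->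
  exists x y : 'rV_n, [/\ presents (M (e |: A)) (col_mx Q x),
    presents (M (f |: A)) (col_mx Q y) &
    presents (M (f |: (e |: A))) (col_mx (col_mx Q x) y)].
Proof.
have [x [y [ix iy ixy]]] := matroid_axiom M A e f.
move=> /(presents_quotients x y)[x' [y' [px py pxy]]]; exists x', y'.
rewrite setUA [_ |: [set e]]setUC ![_ :|: A]setUC.
by split; [move: px|move: py|move: pxy]; apply/presents_iso/lmod_iso_sym.
Qed.

Lemma presents_set0 : presents (M set0) (0 : 'M[R]_(0, r)).
Proof.
apply: presents_iso (lmod_iso_sym M0) _; exists idfun => [y|v]; first by exists y.
split=> [/= ->|[u ->]]; last by rewrite mulmx0.
by exists 0; rewrite mulmx0.
Qed.

(** Start from r generators without relations and add one relation for each
    element of A. *)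
Lemma presents_card A : exists m (Q : 'M[R]_(m, r)), m = #|A| /\ presents (M A) Q.
Proof.
move: {2}#|A| (erefl #|A|) => m; elim: m A => [|m IH] A.
  move=> /eqP; rewrite cards_eq0 => /eqP ->; exists 0%N, 0; rewrite cards0; split=> //.
  exact: presents_set0.
move=> cA; have [e eA] : exists e, e \in A by apply/set0Pn; rewrite -card_gt0 cA.
have [|p [Q [pE pQ]]] := IH (A :\ e).
  by apply/eqP; rewrite -eqSS -cA (cardsD1 e A) eA.
have [x [_ [px _ _]]] := presents_extend e e pQ.
exists (p + 1)%N, (col_mx Q x); rewrite setD1K // in px; split=> //.
by rewrite pE (cardsD1 e A) eA addnC.
Qed.

Lemma primal_one_step : one_step primal.
Proof.
move=> A e eA; have [m [Q [_ pQ]]] := presents_card A.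
have [x [_ [px _ _]]] := presents_extend e e pQ.
by exists m, r, Q, x; split; apply: presents_represents.
Qed.

Lemma primal_two_steps : two_steps primal.
Proof.
move=> A e f eA fA ef; have [m [Q [_ pQ]]] := presents_card A.
have [x [y [px py pxy]]] := presents_extend e f pQ.
by exists m, r, Q, x, y; split; apply: presents_represents.
Qed.

(** Since M(E) = 0, the presenting matrix has full row space, so a homomorphism
    to R/a killing the relations is zero. *)
Lemma primal_top a : primal setT 1 a -> a \is a GRing.unit.
Proof.
move=> [m [n [Q [[g gs gk] [P [L QP LP]]]]]].
have [Z ZE] : exists Z, 1%:M = Z *m Q.
  by apply: factor_rows => u; apply/gk; apply: M_top.
apply/val_le1; have : dvdmx a (1%:M : 'M[R]_1).
  rewrite -[1%:M](subrK (L *m P)) -opprB; apply: dvdmxD; first exact: dvdmxN.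
  by apply: dvdmx_mull; rewrite -[P]mul1mx ZE -mulmxA; apply: dvdmx_mull.
by move=> /dvdmxP/(_ 0 0); rewrite mxE eqxx.
Qed.

(** If M(~: B) is the cokernel of Q, with one row of Q for each element of the
    complement of B, the module of the dual matroid at B is the cokernel of the
    transpose. *)
Definition dual B k a : Prop := exists m (Q : 'M[R]_(m, r)),
  [/\ m = #|~: B|, presents (M (~: B)) Q & onto_free Q^T k a].

(** Presentations of the same size of one module are equivalent matrices, so
    the choice of Q does not matter. *)
Lemma dual_represents B m (Q : 'M[R]_(m, r)) :
  m = #|~: B| -> presents (M (~: B)) Q -> represents Q^T (dual B).
Proof.
move=> mE pQ k a; split=> [[p [Q' [pE pQ']]]|h]; last by exists m, Q.
rewrite -mE in pE; case: m / pE Q pQ mE => Q pQ _.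
have [|A [U [uA uU ->]]] := @onto_free_equivalent _ hR _ _ Q' Q.
  by move=> l b; split; [apply: presents_onto pQ' pQ | apply: presents_onto pQ pQ'].
by rewrite !trmx_mul mulmxA onto_free_equiv ?unitmx_tr.
Qed.

Lemma setC_extend B e : e \notin B -> ~: B = e |: ~: (e |: B).
Proof.
move=> eB; apply/setP => f; rewrite !inE; case: eqP => //= ->.
by rewrite eB.
Qed.

Lemma dual_one_step : one_step dual.
Proof.
move=> B e eB; have [m [Q [mE pQ]]] := presents_card (~: (e |: B)).
have [x [_ [px _ _]]] := presents_extend e e pQ.
rewrite -setC_extend // in px.
have mE' : (m + 1)%N = #|~: B|.
  by rewrite (setC_extend eB) cardsU1 inE setU11 mE addnC.
exists r, (m + 1)%N, (col_mx Q x)^T, (row_mx 0 1%:M); split.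
  exact: dual_represents mE' px.
move=> k a; rewrite (dual_represents mE pQ) tr_col_mx.
by rewrite eliminate_last.
Qed.

(** The square of M below the complement of B u ef, read backwards: deleting a
    row of a presentation kills a generator of the transposed one, that is,
    adds a unit vector as a relation. *)
Lemma dual_two_steps : two_steps dual.
Proof.
move=> B e f eB fB ef; have feB : f \notin e |: B by rewrite !inE negb_or eq_sym ef.
have efB : e \notin f |: B by rewrite !inE negb_or ef.
have [m [Q [mE pQ]]] := presents_card (~: (f |: (e |: B))).
have [x [y [px py pxy]]] := presents_extend e f pQ.
have swap : f |: (e |: B) = e |: (f |: B) by rewrite setUCA.
have De : f |: ~: (f |: (e |: B)) = ~: (e |: B) by rewrite -setC_extend.
have Df : e |: ~: (f |: (e |: B)) = ~: (f |: B) by rewrite swap -setC_extend.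
have D : f |: (e |: ~: (f |: (e |: B))) = ~: B by rewrite Df -setC_extend.
rewrite De in py; rewrite D in pxy; rewrite Df in px.
have cf : (m + 1)%N = #|~: (f |: B)|.
  by rewrite (setC_extend efB) cardsU1 inE setU11 mE addnC -swap.
have ce : (m + 1)%N = #|~: (e |: B)|.
  by rewrite (setC_extend feB) cardsU1 inE setU11 mE addnC.
have c : (m + 1 + 1)%N = #|~: B|.
  by rewrite (setC_extend fB) cardsU1 inE setU11 cf addnC.
exists r, (m + 1 + 1)%N, (col_mx (col_mx Q x) y)^T, (row_mx (row_mx 0 1%:M) 0), (row_mx 0 1%:M).
split.
- exact: dual_represents c pxy.
- move=> k a; rewrite (dual_represents ce py) !tr_col_mx.
  by rewrite eliminate_middle.
- move=> k a; rewrite (dual_represents cf px) [(col_mx _ y)^T]tr_col_mx.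
  by rewrite eliminate_last.
move=> k a; rewrite (dual_represents mE pQ) [(col_mx _ y)^T]tr_col_mx tr_col_mx.
have -> : col_mx (row_mx (row_mx Q^T x^T) y^T) (row_mx (row_mx 0 1%:M) 0) =
          row_mx (col_mx (row_mx Q^T x^T) (row_mx 0 1%:M)) (col_mx y^T 0).
  by rewrite -block_mxEv block_mxEh.
by rewrite !eliminate_last.
Qed.

Lemma dual_top a : dual setT 1 a -> a \is a GRing.unit.
Proof.
move=> [m [Q [mE _]]]; apply: onto_free_rank.
by rewrite mE setCT cards0.
Qed.

Lemma dual_primal A k l a : (k + r = l + #|A|)%N ->
  dual (~: A) k.+1 a <-> primal A l.+1 a.
Proof.
move=> kl; have [m [Q [mE pQ]]] := presents_card A.
have pQ' : presents (M (~: ~: A)) Q by rewrite setCK.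
have mE' : m = #|~: ~: A| by rewrite setCK.
have pr : represents Q (primal A) := presents_represents pQ.
rewrite (dual_represents mE' pQ') pr.
by apply: onto_free_tr => //; rewrite mE.
Qed.

(** With |A| relations among r generators, the rank is at least r - |A|. *)
Lemma primal_generic A k a : (#|A| + k <= r)%N -> primal A k a.
Proof.
move: {2}#|A| (erefl #|A|) => m; elim: m A k => [|m IH] A k.
  move=> /eqP; rewrite cards_eq0 => /eqP ->; rewrite cards0 add0n => kr.
  apply/(presents_represents presents_set0).
  by apply: (onto_free_le kr); exists 1%:M, 1%:M; rewrite ?mulmx1 ?subrr; apply: dvdmx0.
move=> cA kr; have [e eA] : exists e, e \in A by apply/set0Pn; rewrite -card_gt0 cA.
rewrite -(setD1K eA); apply: (family_contract hR primal_one_step).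
  by rewrite !inE eqxx.
have cA' : m = #|A :\ e| by apply/eqP; rewrite -eqSS -cA (cardsD1 e A) eA.
by apply: IH; rewrite // -cA' addnS -addSn -cA.
Qed.

Lemma primal0 A a : primal A 0 a.
Proof.
have [m [Q [_ pQ]]] := presents_card A; apply/(presents_represents pQ).
by exists 0, 0; [rewrite mulmx0 | rewrite [X in dvdmx _ X]flatmx0]; apply: dvdmx0.
Qed.

Lemma primal_extend A k a : A != setT ->
  (forall e, e \notin A -> primal (e |: A) k.+1 a) -> primal A k.+2 a.
Proof.
exact: (family_extend hR primal_one_step primal_two_steps primal_top).
Qed.

Lemma primal_delete A e k a : e \in A -> primal A k a -> primal (A :\ e) k a.
Proof.
move=> eA; rewrite -{1}(setD1K eA).
by apply: (family_mono primal_one_step); rewrite !inE eqxx.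
Qed.

(** [family_extend] for the dual family at the complement of A; the numerical
    hypothesis says that the shifted index is still at least 2. *)
Lemma primal_restore A k a : A != set0 -> (r.+1 < #|A| + k.+1)%N ->
  (forall e, e \in A -> primal (A :\ e) k.+1 a) -> primal A k.+1 a.
Proof.
move=> A0 hk h; move: hk; rewrite addnS ltnS => hk.
have [l lE] : exists l, (l.+1 + r = k + #|A|)%N.
  exists (#|A| + k - r.+1)%N; by rewrite addSnnS subnK // addnC.
apply/(dual_primal _ lE).
apply: (family_extend hR dual_one_step dual_two_steps dual_top).
  by rewrite -setC0 (inj_eq (can_inj setCK)).
move=> e; rewrite inE negbK => eA.
have -> : e |: ~: A = ~: (A :\ e) by rewrite setCD setUC.
apply/(dual_primal (l := k)); last exact: h.
by apply/eqP; rewrite -eqSS -addSn lE (cardsD1 e A) eA addnCA add1n.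
Qed.

End MatroidFamilies.

(** * Transfer from r-sets to all sets *)

Section Transfer.
Variables (R : idomainType) (E : finType) (M M' : matroid R E) (r : nat).
Hypothesis hR : valuation_ring R.
Hypothesis M0 : lmod_iso (M set0) 'rV[R]_r.
Hypothesis M0' : lmod_iso (M' set0) 'rV[R]_r.
Hypothesis M_top : spannable M.
Hypothesis M_top' : spannable M'.
Hypothesis bases : forall A : {set E}, #|A| = r -> lmod_iso (M A) (M' A).
Implicit Types (A : {set E}) (a : R).

Lemma onto_module_iso (U V : lmodType R) k a :
  lmod_iso U V -> onto_module U k a -> onto_module V k a.
Proof.
by move=> i [m [n [Q [pQ h]]]]; exists m, n, Q; split; first exact: presents_iso i pQ.
Qed.

(** Below |A| + k = r + 1 nothing depends on the matroid.  On that line the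
    index k decreases as A grows, and the recursion stops at k = 1 and |A| = r. *)
Lemma primal_transfer_small A k a : (#|A| + k <= r.+1)%N ->
  primal M A k a -> primal M' A k a.
Proof.
elim: k A => [|k IH] A; first by move=> _ _; apply: primal0 M0' A a.
rewrite leq_eqVlt ltnS => /predU1P[Ak|Ak _]; last exact: primal_generic Ak.
case: k IH Ak => [|k] IH Ak.
  by apply/onto_module_iso/bases; move: Ak; rewrite addn1 => -[].
move=> h; apply: (primal_extend hR M0' M_top') => [|e eA].
  (* If A were E, then M'(E) would have rank at least one. *)
  apply/eqP => AT; have : primal M' setT 1 0.
    apply: (primal_generic hR M0'); rewrite -AT -ltnS -Ak.
    by rewrite addn1 !addnS !ltnS leq_addr.
  by move=> /(primal_top M_top'); rewrite unitr0.
apply: IH; first by rewrite cardsU1 eA -Ak addnAC addnC addnS add1n addnS.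
exact: (family_contract hR (primal_one_step M0)).
Qed.

(** Above the line |A| + k = r + 1, delete elements of A until the line or the
    empty set is reached. *)
Lemma primal_transfer A k a : primal M A k a -> primal M' A k a.
Proof.
case: k => [|k] h; first exact: primal0 M0' A a.
move: {2}#|A| (erefl #|A|) h => m; elim: m A => [|m IH] A cA h.
  apply: onto_module_iso h; move/eqP: cA; rewrite cards_eq0 => /eqP ->.
  exact/(lmod_iso_trans M0)/lmod_iso_sym.
have [small|big] := leqP (#|A| + k.+1)%N r.+1; first exact: primal_transfer_small small h.
apply: (primal_restore hR M0' _ big) => [|e eA]; first by rewrite -card_gt0 cA.
apply: IH; last exact: (primal_delete M0 eA h).
by apply/eqP; rewrite -eqSS -cA (cardsD1 e A) eA.
Qed.

End Transfer.

Theorem corollary4p8 (R : idomainType) (hR : valuation_ring R)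
    (E : finType) (r : nat) (M M' : matroid R E)
    (hM : bispannable M) (hM' : bispannable M')
    (hr : lmod_iso (M set0) 'rV[R]_r) (hr' : lmod_iso (M' set0) 'rV[R]_r)
    (hbases : forall A : {set E}, #|A| = r -> lmod_iso (M A) (M' A)) :
  forall A : {set E}, lmod_iso (M A) (M' A).
Proof.
move=> A; have [M_top _] := hM; have [M_top' _] := hM'.
have hbases' (B : {set E}) : #|B| = r -> lmod_iso (M' B) (M B) by move/hbases/lmod_iso_sym.
have [m [Q [mE pQ]]] := presents_card hr A.
have [m' [Q' [mE' pQ']]] := presents_card hr' A.
rewrite -mE in mE'; case: m / mE' Q mE pQ => Q mE pQ.
have [k a|A1 [U [uA uU QE]]] := @onto_free_equivalent _ hR _ _ Q Q'.
  rewrite -(presents_represents pQ) -(presents_represents pQ').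
  split=> h; first exact: (primal_transfer hR hr hr' M_top' hbases h).
  exact: (primal_transfer hR hr' hr M_top hbases' h).
apply: presents_unique pQ'; rewrite QE; exact: presents_equiv.
Qed.
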